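(* Let $S$ be a linear operator acting on a Hilbert space $\mathcal{H}$. The following statements are equivalent: (i) $S$ is (densely defined and) skewadjoint; (ii) (a) $S\wedge(-S)$; (b) $\operatorname{ran}(\lambda+S)=\mathcal{H}$; (c) $\overline{\operatorname{ran}(\lambda-S)}=\mathcal{H}$, for a certain (and also for all) $\lambda\in\mathbb{R}$, $\lambda\neq0$.
   Context: Hilbert spaces are real or complex. A linear operator $S$ on $\mathcal{H}$ is a linear map $S:\operatorname{dom}S\to\mathcal{H}$ defined on a linear subspace $\operatorname{dom}S\subseteq\mathcal{H}$; it is not assumed bounded, closed or densely defined. The operators $\lambda\pm S$ have domain $\operatorname{dom}S$. The adjoint $S^*$ of a densely defined $S$ has domain $\{k:\exists h'\ \forall h\in\operatorname{dom}S,\ \langle Sh,k\rangle=\langle h,h'\rangle\}$ and $S^*k:=h'$. $S$ is skewadjoint if it is densely defined and $S^*=-S$ (with equal domains). $S\wedge(-S)$ means $\langle Sh,k\rangle=\langle h,-Sk\rangle$ for all $h,k\in\operatorname{dom}S$. ''For a certain (and also for all) $\lambda$'' means: statement (ii) with ''for some $\lambda$'' (the same $\lambda$ in (b) and (c)) and statement (ii) with ''for all $\lambda$'' are both equivalent to (i). *)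

(* Defs.v *)
From HB Require Import structures.
From mathcomp Require Import all_boot all_order all_algebra.
From mathcomp Require Import complex.
From mathcomp Require Import all_classical all_reals all_analysis.

Set Implicit Arguments.
Unset Strict Implicit.
Unset Printing Implicit Defensive.

Import Order.TTheory GRing.Theory Num.Theory.
Import numFieldNormedType.Exports.

Local Open Scope classical_set_scope.
Local Open Scope ring_scope.

Variant scalar_kind := RealScalars | ComplexScalars.

Definition scalar_field (R : realType) (k : scalar_kind) : numFieldType :=
  match k with
  | RealScalars => R
  | ComplexScalars => R[i]
  end.

Definition scalar_conj (R : realType) (k : scalar_kind) :
    scalar_field R k -> scalar_field R k :=
  match k with
  | RealScalars => idfun
  | ComplexScalars => @Num.conj R[i]
  end.

(* A Hilbert space is a complete normed module whose norm comes from an inner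
   product; ip is linear in its first argument, theta-linear in its second. *)
Definition norm_of_dot (K : numFieldType) (theta : K -> K)
    (H : normedModType K) (ip : {dot H for theta}) : Prop :=
  forall h : H, `|h| ^+ 2 = ip h h.

(* A map defined on a subset of H. The values of [app] outside [dom] are
   irrelevant: every notion below only evaluates [app] on [dom]. *)
Record partial_map (H : Type) := PartialMap {
  dom : set H;
  app :> H -> H
}.

Definition pmap_eq (H : Type) (S T : partial_map H) : Prop :=
  dom S = dom T /\ forall h, dom S h -> S h = T h.

Definition ran (H : Type) (S : partial_map H) : set H := S @` dom S.

Section LinearOperators.
Context (K : numFieldType) (H : normedModType K).
Implicit Types (S T : partial_map H) (lam : K).

Definition linear_operator S : Prop :=
  [/\ dom S 0,
      forall (a : K) (u v : H), dom S u -> dom S v -> dom S (a *: u + v) &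
      forall (a : K) (u v : H), dom S u -> dom S v ->
        S (a *: u + v) = a *: S u + S v].

Definition pmap_opp S : partial_map H :=
  PartialMap (dom S) (fun h => - S h).

Definition scalar_add lam S : partial_map H :=
  PartialMap (dom S) (fun h => lam *: h + S h).

Definition scalar_sub lam S : partial_map H :=
  PartialMap (dom S) (fun h => lam *: h - S h).

Definition densely_defined S : Prop := dense (dom S).

Context (theta : K -> K) (ip : {dot H for theta}).

Definition adjoint_rel S (k h' : H) : Prop :=
  forall h, dom S h -> ip (S h) k = ip h h'.

(* The vector h' picked below is unique when S is densely defined, the only
   case in which the adjoint is used. *)
Definition adjoint S : partial_map H :=
  PartialMap [set k | exists h', adjoint_rel S k h']
             (fun k => xget 0 [set h' | adjoint_rel S k h']).

Definition skewadjoint S : Prop :=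
  densely_defined S /\ pmap_eq (adjoint S) (pmap_opp S).

Definition formally_adjoint S T : Prop :=
  forall h k, dom S h -> dom T k -> ip (S h) k = ip h (T k).

End LinearOperators.

(* Main.v *)
Require Import Defs.
From mathcomp Require Import all_boot all_order all_algebra.
From mathcomp Require Import complex.
From mathcomp Require Import all_classical all_reals all_analysis.
From mathcomp Require Import ring.

Set Implicit Arguments.
Unset Strict Implicit.

Import Order.TTheory GRing.Theory Num.Theory.
Import numFieldNormedType.Exports.

Local Open Scope classical_set_scope.
Local Open Scope ring_scope.

(** Why the theorem holds. If S is formally adjoint to -S and lam is real, the
    cross terms of |lam h + S h|^2 cancel, so that lam + S is bounded below by
    |lam| ([skew_lower_bound]).

    Let S be skewadjoint. A vector y orthogonal to ran (lam + S) lies in the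
    domain of the adjoint, hence in dom S, and satisfies S y = lam y; so
    2 lam y = (lam + S) y is in the range as well, and y is orthogonal to
    itself up to a nonzero factor, that is y = 0. By the projection theorem
    ran (lam + S) is dense. The lower bound makes preimages of a convergent
    net in this range convergent, and S is closed because it is, up to sign,
    an adjoint; so the range is everything ([skewadjoint_ran_add]). Applying
    this to -lam gives ran (lam - S).

    Conversely, moving the operator across the inner product gives
    <(lam - S) h, g> = <h, (lam + S) g> on dom S. Solving (lam + S) g = y for
    y orthogonal to dom S shows that g is orthogonal to the dense set
    ran (lam - S), hence y = 0: the domain is dense. Solving
    (lam + S) g = lam k - S^* k for k in dom S^* shows in the same way that
    k = g, hence k is in dom S and S^* k = - S k ([skewadjoint_of_ran]).

    The real and complex cases are treated together. The arguments are carried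
    out over an arbitrary numFieldType with two properties that R and R[i]
    share: nonempty sets of nonnegative elements have an infimum, and theta
    fixes the reals and satisfies x * theta x = |x|^2. *)

(** * Real and complex scalars *)

(** This replaces completeness of the order, which makes no sense over R[i]
    since complex numbers are only partially ordered; distances are
    nonnegative, and this is all that the projection theorem needs. *)
Definition nonneg_sets_have_inf (K : numFieldType) : Prop :=
  forall A : set K, A !=set0 -> (forall x, A x -> 0 <= x) ->
  exists2 d : K, 0 <= d /\ (forall x, A x -> d <= x) &
    forall e, 0 < e -> exists2 x, A x & x < d + e.

Definition conjugation (K : numFieldType) (theta : K -> K) : Prop :=
  {in Num.real, theta =1 id} /\ forall x, x * theta x = `|x| ^+ 2.

Lemma scalar_field_inf (R : realType) (k : scalar_kind) :
  nonneg_sets_have_inf (scalar_field R k).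
Proof.
case: k => /=.
  move=> A A0 Age0; have lbA : lbound A 0 by move=> x /Age0.
  exists (inf A).
    by split=> [|x Ax]; [exact: lb_le_inf|apply: ge_inf => //; exists 0].
  move=> e e0; have [|x Ax xe] := @inf_adherent _ A e e0; last by exists x.
  by split=> //; exists 0.
move=> A [a Aa] Age0; set B := [set r : R | A r%:C%C].
have liftB x : A x -> exists2 r, B r & x = r%:C%C.
  move=> Ax; exists (complex.Re x); rewrite /B /= RRe_real//;
  exact: ger0_real (Age0 _ Ax).
have B0 : B !=set0 by have [r Br _] := liftB _ Aa; exists r.
have lbB : lbound B 0 by move=> r /Age0; rewrite ler0c.
exists (inf B)%:C%C; first split.
- by rewrite ler0c lb_le_inf.
- by move=> x /liftB[r Br ->]; rewrite lecR; apply: ge_inf => //; exists 0.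
- move=> e e0; have eR : e \is Num.real by exact: gtr0_real.
  have := e0; rewrite -(RRe_real eR) ltcR => re0.
  have [|r Br re] := @inf_adherent _ B _ re0; first by split=> //; exists 0.
  by exists r%:C%C => //; rewrite -rmorphD/= ltcR.
Qed.

Lemma scalar_conj_conjugation (R : realType) (k : scalar_kind) :
  conjugation (@scalar_conj R k).
Proof.
case: k; split=> //=.
- by move=> x; rewrite -expr2 real_normK ?num_real.
- by move=> x xR; exact: conj_Creal.
- by move=> x; rewrite normCK.
Qed.

(** * Density in terms of the norm *)

Definition norm_dense (K : numFieldType) (H : normedModType K) (A : set H) :=
  forall z e, 0 < e -> exists2 m, A m & `|z - m| < e.

Lemma closure_eqT (K : numFieldType) (H : normedModType K) (A : set H) :
  closure A = setT <-> @norm_dense K H A.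
Proof.
split=> [clA z e e0|dA].
  have : closure A z by rewrite clA.
  move=> /(_ _ (nbhsx_ballx z e e0))[m [Am zm]]; exists m => //.
  by move: zm; rewrite -ball_normE.
apply/seteqP; split=> // z _ B /nbhs_normP[e e0 eB].
by have [m Am zm] := dA z e e0; exists m; split=> //; exact: eB.
Qed.

Lemma denseP (K : numFieldType) (H : normedModType K) (A : set H) :
  dense A <-> @norm_dense K H A.
Proof.
split=> [dA z e e0|dA U [z Uz] oU].
  have [||m [zm Am]] := dA (ball z e)^°.
  - exists z; apply: nbhs_singleton; apply: nbhs_interior.
    exact: nbhsx_ballx.
  - exact: open_interior.
  - by exists m => //; move: (interior_subset zm); rewrite -ball_normE.
have /nbhs_normP[e e0 eU] : nbhs z U by exact: open_nbhs_nbhs.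
by have [m Am zm] := dA z e e0; exists m; split=> //; exact: eU.
Qed.

(** * Inner products *)

Section InnerProduct.
Context (K : numFieldType) (H : normedModType K) (theta : K -> K).
Context (ip : {dot H for theta}).
Hypotheses (theta_conj : conjugation theta) (ip_norm : norm_of_dot ip).

(* Sesquilinearity, stated for [ip] as a dot product: rewriting with the rules
   for bilinear maps would replace [ip] by its underlying bilinear map, which
   the lemmas below do not match. *)

Lemma ip_sym (u v : H) : ip u v = theta (ip v u).
Proof. by rewrite (hermitian_subproof u v) expr0 mul1r. Qed.

Lemma ipDl (u v w : H) : ip (u + v) w = ip u w + ip v w.
Proof. exact: linearDl. Qed.

Lemma ipDr (u v w : H) : ip u (v + w) = ip u v + ip u w.
Proof. exact: linearDr. Qed.

Lemma ipNl (u v : H) : ip (- u) v = - ip u v.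
Proof. exact: linearNl. Qed.

Lemma ipNr (u v : H) : ip u (- v) = - ip u v.
Proof. exact: linearNr. Qed.

Lemma ipZl (a : K) (u v : H) : ip (a *: u) v = a * ip u v.
Proof. exact: linearZl_LR. Qed.

Lemma ipZr (a : K) (u v : H) : ip u (a *: v) = theta a * ip u v.
Proof. exact: linearZr_LR. Qed.

Lemma ip_real_scaler (a : K) (u v : H) :
  a \is Num.real -> ip u (a *: v) = a * ip u v.
Proof. by move=> aR; rewrite ipZr theta_conj.1. Qed.

Lemma ip_eq0_sym (u v : H) : ip u v = 0 -> ip v u = 0.
Proof. by move=> uv0; rewrite ip_sym uv0; exact: theta_conj.1 (real0 _). Qed.

Lemma sqnormD (u v : H) :
  `|u + v| ^+ 2 = `|u| ^+ 2 + `|v| ^+ 2 + (ip u v + ip v u) :> K.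
Proof. by rewrite !ip_norm !(ipDl, ipDr); ring. Qed.

Lemma parallelogram (u v : H) :
  `|u + v| ^+ 2 + `|u - v| ^+ 2 = 2 * (`|u| ^+ 2 + `|v| ^+ 2).
Proof. by rewrite !sqnormD normrN ipNr ipNl; ring. Qed.

(** Subtracting from x its projection on the line of v removes exactly the
    square of the component along v. This single identity gives both the
    Cauchy-Schwarz inequality and the orthogonality of the nearest-point
    residual. The convention 1 / 0 = 0 makes it hold for v = 0 too. *)
Lemma sqnorm_residual (x v : H) :
  `|x - (ip x v / `|v| ^+ 2) *: v| ^+ 2 =
  `|x| ^+ 2 - `|ip x v| ^+ 2 / `|v| ^+ 2.
Proof.
have [->|v0] := eqVneq v 0.
  by rewrite scaler0 subr0 normr0 expr0n invr0 mulr0 subr0.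
have vv0 : `|v| ^+ 2 != 0 by rewrite expf_eq0 normr_eq0.
set c := ip x v / _.
have cv : c * theta c = `|ip x v| ^+ 2 / `|v| ^+ 4.
  rewrite theta_conj.2 normrM exprMn normfV [`|_ ^+ 2|]ger0_norm ?exprn_ge0//.
  by rewrite exprVn -exprM.
have vx : c * ip v x = `|ip x v| ^+ 2 / `|v| ^+ 2.
  by rewrite (ip_sym v x) /c mulrAC (theta_conj.2 (ip x v)).
have xv : theta c * ip x v = `|ip x v| ^+ 2 / `|v| ^+ 2.
  have {1}-> : ip x v = c * `|v| ^+ 2 by rewrite /c divfK.
  by rewrite mulrA [theta c * c]mulrC cv; field; rewrite normr_eq0.
rewrite sqnormD ipNl ipNr ipZr ipZl xv vx normrN normrZ exprMn.
by rewrite -theta_conj.2 cv; field; rewrite normr_eq0.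
Qed.

Lemma cauchy_schwarz (x v : H) : `|ip x v| <= `|x| * `|v|.
Proof.
have [->|v0] := eqVneq v 0; first by rewrite linear0r !normr0 mulr0.
have vv0 : 0 < `|v| ^+ 2 by rewrite exprn_gt0 ?normr_gt0.
rewrite -ler_sqr ?nnegrE ?mulr_ge0// exprMn -ler_pdivrMr// -subr_ge0.
by rewrite -sqnorm_residual exprn_ge0.
Qed.

(** For m in M, Pythagoras gives |y| <= |y - m|, so a nonzero y cannot be
    approximated by M within |y|. *)
Lemma dense_orthogonal_eq0 (M : set H) y :
  norm_dense M -> (forall m, M m -> ip m y = 0) -> y = 0.
Proof.
move=> dM My; apply/eqP; apply: contraT => y0.
have [|m Mm] := dM y `|y|; first by rewrite normr_gt0.
rewrite -ltr_sqr ?nnegrE// sqnormD normrN ipNl ipNr My//.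
rewrite (ip_eq0_sym (My _ Mm)) oppr0 !addr0 => /lt_geF.
by rewrite lerDl exprn_ge0.
Qed.

End InnerProduct.

(** * The projection theorem *)

(** Cantor's intersection principle for sets that need not be closed: they
    generate a Cauchy filter, whose limit is close to them but need not lie
    in them. *)
Lemma shrinking_sets_limit (K : numFieldType) (H : completeNormedModType K)
    (A : K -> set H) :
  (forall e, 0 < e -> A e !=set0) ->
  (forall e e', 0 < e -> e <= e' -> A e `<=` A e') ->
  (forall e x y, 0 < e -> A e x -> A e y -> `|x - y| < e) ->
  exists z, forall e, 0 < e -> exists2 x, A e x & `|z - x| < e.
Proof.
move=> A0 mA smallA; pose F := filter_from [set e : K | 0 < e] A.
have FF : ProperFilter F.
  apply: filter_from_proper => [|e e0]; last exact: A0.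
  apply: filter_from_filter => [|e e' /= e0 e'0]; first by exists 1 => /=.
  have p0 : 0 < e * e' / (e + e') by rewrite divr_gt0 ?mulr_gt0 ?addr_gt0.
  (* a lower bound of e and e' that does not require comparing them *)
  exists (e * e' / (e + e')) => //.
  move=> x Ax; split; apply: mA Ax => //; rewrite ler_pdivrMr ?addr_gt0//.
    by rewrite ler_pM2l// lerDr ltW.
  by rewrite mulrC ler_pM2l// lerDl ltW.
have : cvg F.
  apply/cauchy_cvgP/cauchy_exP => e e0; have [x Ax] := A0 _ e0.
  by exists x, e => //= y Ay; rewrite -ball_normE; exact: smallA Ax Ay.
move=> /cvg_ex[z Fz]; exists z => e e0.
have FAe : F (A e) by exists e.
have Fze : F [set x | `|z - x| < e].
  by apply: Fz; apply/nbhs_normP; exists e.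
by have [x [Ax zx]] := filter_ex (filterI FAe Fze); exists x.
Qed.

Section Projection.
Context (K : numFieldType) (H : completeNormedModType K) (theta : K -> K).
Context (ip : {dot H for theta}).
Hypotheses (theta_conj : conjugation theta) (ip_norm : norm_of_dot ip).
Hypothesis Kinf : nonneg_sets_have_inf K.

(** The points of M that are almost at minimal distance d from y form sets of
    vanishing diameter, by the parallelogram law and because midpoints stay in
    M. Their limit z lies in the closure of M and realizes the distance, and
    moving z by an element of M stays in that closure. *)
Lemma nearest_point (M : set H) y :
  M 0 -> (forall (a : K) u v, M u -> M v -> M (a *: u + v)) ->
  exists2 z, (forall e, 0 < e -> exists2 m, M m & `|z - m| < e) &
    forall m, M m -> `|y - z| <= `|y - z - m|.
Proof.
move=> M0 Mlin.
have [||d [d0 dle] dinf] := @Kinf [set `|y - m| | m in M].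
- by exists `|y - 0|, 0.
- by move=> _ [m _ <-].
have {dinf} Minf e : 0 < e -> exists2 m, M m & `|y - m| < d + e.
  by move=> /dinf[_ [m Mm <-]]; exists m.
(* the slack e^2 / 4 makes the parallelogram law bound the diameter by e *)
pose A (e : K) := [set m | M m /\ `|y - m| ^+ 2 < d ^+ 2 + e ^+ 2 / 4].
have A0 e : 0 < e -> A e !=set0.
  (* f is such that (d + f)^2 <= d^2 + e^2 / 4 *)
  move=> e0; pose f := e ^+ 2 / 4 / (2 * d + 1 + e).
  have den0 : 0 < 2 * d + 1 + e by rewrite addr_gt0// ltr_wpDl ?mulr_ge0.
  have f0 : 0 < f by rewrite !divr_gt0// exprn_gt0.
  have fe : f <= e.
    rewrite /f -mulrA expr2 -mulrA ger_pMr// mulrA ler_pdivrMr// mul1r.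
    rewrite ler_pdivrMr// -subr_ge0.
    have -> : (2 * d + 1 + e) * 4 - e = 8 * d + 4 + 3 * e by ring.
    apply: addr_ge0; last by rewrite mulr_ge0// ltW.
    by apply: addr_ge0 => //; exact: mulr_ge0.
  have [m Mm ym] := Minf _ f0; exists m; split=> //.
  apply: (@lt_le_trans _ _ ((d + f) ^+ 2)).
    by rewrite ltr_sqr ?nnegrE ?addr_ge0 ?(ltW f0).
  have -> : (d + f) ^+ 2 = d ^+ 2 + f * (2 * d + f) by ring.
  have -> : e ^+ 2 / 4 = f * (2 * d + 1 + e) by rewrite /f divfK ?gt_eqF.
  rewrite lerD2l ler_pM2l// -addrA lerD2l.
  by rewrite (le_trans fe)// lerDr.
have [e e' e0 ee' m [Mm ym]|e m m' e0 [Mm ym] [Mm' ym']|z zA] :=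
  @shrinking_sets_limit _ H A A0.
- split=> //; apply: (lt_le_trans ym).
  rewrite lerD2l ler_pM2r ?invr_gt0//.
  by rewrite ler_sqr ?nnegrE ?(le_trans (ltW e0) ee') ?(ltW e0).
- have mid : d ^+ 2 *+ 4 <= `|(y - m) + (y - m')| ^+ 2.
    have Mmid : M (2^-1 *: (m + m')).
      rewrite -[X in M X]addr0; apply: (Mlin) => //.
      by rewrite -[m]scale1r; exact: Mlin.
    have -> : (y - m) + (y - m') = 2 *: (y - 2^-1 *: (m + m')).
      rewrite scalerBr scalerA divff// scale1r scaler_nat mulr2n opprD.
      by rewrite addrACA.
    rewrite normrZ exprMn normr_nat -mulr_natl.
    have -> : 2%:R ^+ 2 = 4%:R :> K by ring.
    rewrite ler_pM2l// ler_sqr ?nnegrE//.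
    by apply: dle; exists (2^-1 *: (m + m')).
  rewrite -ltr_sqr ?nnegrE ?(ltW e0)//.
  have -> : `|m - m'| = `|(y - m) - (y - m')|.
    by rewrite opprB [_ + (m' - y)]addrC subrKA distrC.
  have par := parallelogram ip_norm (y - m) (y - m').
  have -> : `|(y - m) - (y - m')| ^+ 2 =
      2 * (`|y - m| ^+ 2 + `|y - m'| ^+ 2) - `|(y - m) + (y - m')| ^+ 2.
    by rewrite -par; ring.
  rewrite ltrBlDr.
  apply: (@lt_le_trans _ _ (e ^+ 2 + d ^+ 2 *+ 4)); last by rewrite lerD2l.
  have -> : e ^+ 2 + d ^+ 2 *+ 4 =
      2 * ((d ^+ 2 + e ^+ 2 / 4) + (d ^+ 2 + e ^+ 2 / 4)) by field.
  by rewrite ltr_pM2l// ltrD.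
exists z => [e e0|m Mm]; first by have [m [Mm _] zm] := zA _ e0; exists m.
have yz : `|y - z| <= d.
  apply/ler_addgt0Pr => e e0; have e20 : 0 < e / 2 by rewrite divr_gt0.
  have [w [Mw yw] zw] := zA _ e20.
  have yw' : `|y - w| <= d + e / 2.
    rewrite -ler_sqr ?nnegrE ?addr_ge0 ?(ltW e20)// (le_trans (ltW yw))//.
    have -> : (d + e / 2) ^+ 2 =
      d ^+ 2 + (e / 2) ^+ 2 / 4 + (d * e + 3 * ((e / 2) ^+ 2 / 4)) by field.
    have q0 : 0 <= (e / 2) ^+ 2 / 4 by rewrite divr_ge0// exprn_ge0 ?(ltW e20).
    by rewrite lerDl addr_ge0 ?mulr_ge0 ?(ltW e0).
  have -> : y - z = (y - w) + (w - z) by rewrite addrA subrK.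
  rewrite (le_trans (ler_normD _ _))// [e in leRHS]splitr addrA lerD//.
  by rewrite distrC ltW.
apply: (le_trans yz); apply/ler_addgt0Pr => e e0.
have [w [Mw _] zw] := zA _ e0.
apply: (@le_trans _ _ `|y - (w + m)|).
  by apply: dle; exists (w + m) => //; rewrite -[w]scale1r; exact: Mlin.
have -> : y - (w + m) = (y - z - m) + (z - w).
  by rewrite addrAC addrA subrK opprD addrA [_ - w - m]addrAC.
by rewrite (le_trans (ler_normD _ _))// lerD2l ltW.
Qed.

(** The residual y - z at the nearest point z is orthogonal to M: a nonzero
    component along some m would allow a strictly closer point. *)
Lemma dense_of_orthogonal_eq0 (M : set H) :
  M 0 -> (forall (a : K) u v, M u -> M v -> M (a *: u + v)) ->
  (forall y, (forall m, M m -> ip m y = 0) -> y = 0) -> norm_dense M.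
Proof.
move=> M0 Mlin Morth y; have [z zM ymin] := nearest_point y M0 Mlin.
suff -> : y = z by [].
apply/eqP; rewrite -subr_eq0; apply/eqP/Morth => m Mm.
have [->|m0] := eqVneq m 0; first exact: linear0l.
apply: (ip_eq0_sym theta_conj).
set c := ip (y - z) m / `|m| ^+ 2.
have Mcm : M (c *: m) by rewrite -[X in M X]addr0; exact: Mlin.
have m2 : 0 < `|m| ^+ 2 by rewrite exprn_gt0 ?normr_gt0.
have := ymin _ Mcm.
rewrite -ler_sqr ?nnegrE// (sqnorm_residual theta_conj ip_norm).
rewrite lerDl oppr_ge0 ler_pdivrMr// mul0r => le0.
have : `|ip (y - z) m| ^+ 2 == 0 by rewrite eq_le le0 exprn_ge0.
by rewrite expf_eq0 normr_eq0 => /eqP.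
Qed.

End Projection.

(** * Skewadjoint operators *)

Section Skewadjoint.
Context (K : numFieldType) (H : completeNormedModType K) (theta : K -> K).
Context (ip : {dot H for theta}).
Hypotheses (theta_conj : conjugation theta) (ip_norm : norm_of_dot ip).
Hypothesis Kinf : nonneg_sets_have_inf K.
Context (S : partial_map H).
Hypothesis S_linear : linear_operator S.
Implicit Types (lam : K) (h g y z : H).

Let dom0 : dom S 0. Proof. by case: S_linear. Qed.

Let domP (a : K) u v : dom S u -> dom S v -> dom S (a *: u + v).
Proof. by case: S_linear => _ + _; apply. Qed.

Let appP (a : K) u v :
  dom S u -> dom S v -> S (a *: u + v) = a *: S u + S v.
Proof. by case: S_linear => _ _; apply. Qed.

Let domB u v : dom S u -> dom S v -> dom S (u - v).
Proof. by move=> du dv; rewrite addrC -scaleN1r; exact: domP. Qed.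

Let appB u v : dom S u -> dom S v -> S (u - v) = S u - S v.
Proof.
by move=> du dv; rewrite addrC -scaleN1r appP// scaleN1r addrC.
Qed.

Lemma ran_scalar_add_subspace lam :
  ran (scalar_add lam S) 0 /\
  forall (a : K) u v, ran (scalar_add lam S) u -> ran (scalar_add lam S) v ->
    ran (scalar_add lam S) (a *: u + v).
Proof.
split=> [|a _ _ [h dh <-] [g dg <-]] /=.
  exists 0 => //=; rewrite scaler0 add0r.
  by have := appB dom0 dom0; rewrite !subrr.
exists (a *: h + g) => /=; first exact: domP.
by rewrite appP// !scalerDr !scalerA [lam * a]mulrC addrACA.
Qed.

(** Since lam is real, the two cross terms of |lam h + S h|^2 are
    lam <h, S h> and lam <S h, h>, and formal skewness makes them opposite. *)
Lemma skew_lower_bound lam h :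
  lam \is Num.real -> formally_adjoint ip S (pmap_opp S) -> dom S h ->
  `|lam| * `|h| <= `|lam *: h + S h|.
Proof.
move=> lamR Sskew dh; rewrite -normrZ -ler_sqr ?nnegrE//.
rewrite (sqnormD ip_norm) ipZl (ip_real_scaler _ theta_conj)//.
by rewrite (Sskew h h dh dh) /= ipNr mulrN addrN addr0 lerDl exprn_ge0.
Qed.

Lemma skewadjoint_formally_adjoint :
  skewadjoint ip S -> formally_adjoint ip S (pmap_opp S).
Proof.
move=> [_ [dE aE]] h k dh dk; have dk' : dom (adjoint ip S) k by rewrite dE.
have adj := xgetPex 0 dk'.
by rewrite -aE//; exact: adj.
Qed.

(** This avoids the choice operator in the definition of the adjoint: any
    witness h' will do, by density of dom S. *)
Lemma skewadjoint_maximal k h' :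
  skewadjoint ip S -> adjoint_rel ip S k h' -> dom S k /\ S k = - h'.
Proof.
move=> skewS adj; have [/denseP dS [dE aE]] := skewS.
have dk : dom S k.
  have : dom (adjoint ip S) k by exists h'.
  by rewrite dE.
split=> //; apply/eqP; rewrite -subr_eq0 opprK; apply/eqP.
apply: (dense_orthogonal_eq0 theta_conj ip_norm dS) => h dh.
rewrite ipDr -(adj h dh) (skewadjoint_formally_adjoint skewS dh dk) /= ipNr.
by rewrite addrN.
Qed.

(** S is closed: the relation <S k, g> = <k, - S g>, for a fixed k in dom S,
    passes to limits in the graph of S, so such a limit satisfies the relation
    defining the adjoint. *)
Lemma skewadjoint_closed h s :
  skewadjoint ip S ->
  (forall e, 0 < e ->
    exists2 g, dom S g & `|h - g| < e /\ `|s - S g| < e) ->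
  dom S h /\ S h = s.
Proof.
move=> skewS hs.
suff : adjoint_rel ip S h (- s).
  by move=> /(skewadjoint_maximal skewS); rewrite opprK.
move=> k dk; apply/eqP; rewrite -subr_eq0 -normr_le0.
apply/ler_addgt0Pr => e e0.
have c0 : 0 < `|S k| + `|k| + 1 by rewrite ltr_wpDl// addr_ge0.
have [g dg [hg sg]] := hs _ (divr_gt0 e0 c0).
have -> : ip (S k) h - ip k (- s) = ip (S k) (h - g) + ip k (s - S g).
  rewrite !ipDr !ipNr (skewadjoint_formally_adjoint skewS dk dg) /= ipNr.
  by ring.
rewrite add0r (le_trans (ler_normD _ _))//.
have cs := cauchy_schwarz theta_conj ip_norm.
rewrite (le_trans (lerD (cs _ _) (cs _ _)))//.
apply: (@le_trans _ _ ((`|S k| + `|k|) * (e / (`|S k| + `|k| + 1)))).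
  by rewrite mulrDl lerD// ler_wpM2l// ltW.
by rewrite mulrA ler_pdivrMr// mulrC ler_pM2l// lerDl.
Qed.

(** A vector y orthogonal to the range satisfies S y = lam y, so that
    lam y + S y = 2 lam y; orthogonality to this element of the range forces
    y = 0. *)
Lemma skewadjoint_ran_dense lam :
  skewadjoint ip S -> lam \is Num.real -> lam != 0 ->
  norm_dense (ran (scalar_add lam S)).
Proof.
move=> skewS lamR lam0; have [ran0 ranP] := ran_scalar_add_subspace lam.
apply: (dense_of_orthogonal_eq0 theta_conj ip_norm Kinf ran0 ranP) => y yorth.
have [|dy Sy] := @skewadjoint_maximal y (- lam *: y) skewS.
  move=> h dh; have := yorth _ (imageP (scalar_add lam S) dh).
  rewrite /= ipDl ipZl => /eqP; rewrite addrC addr_eq0 => /eqP ->.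
  by rewrite (ip_real_scaler _ theta_conj) ?realN// mulNr.
have := yorth _ (imageP (scalar_add lam S) dy).
rewrite /= Sy scaleNr opprK -scalerDl ipZl -ip_norm => /eqP.
rewrite mulf_eq0 -mulr2n mulrn_eq0 (negbTE lam0)/= expf_eq0 normr_eq0.
by move=> /eqP.
Qed.

(** The approximate solutions of lam h + S h = y form sets of vanishing
    diameter by the lower bound; at their limit h, the values S g tend to
    y - lam h, and closedness of S makes h an exact solution. *)
Lemma skewadjoint_ran_add lam :
  skewadjoint ip S -> lam \is Num.real -> lam != 0 ->
  ran (scalar_add lam S) = setT.
Proof.
move=> skewS lamR lam0; apply/seteqP; split=> // y _.
have lamgt0 : 0 < `|lam| by rewrite normr_gt0.
(* |lam| e / 2 makes the diameter of A e at most e *)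
pose A e := [set h | dom S h /\ `|y - (lam *: h + S h)| < `|lam| * e / 2].
have ranD := skewadjoint_ran_dense skewS lamR lam0.
have [e e0|e e' e0 ee' h [dh yh]|e h g e0 [dh yh] [dg yg]|h hA] :=
  @shrinking_sets_limit _ H A.
- have [|_ [h dh <-] yh] := ranD y (`|lam| * e / 2); last by exists h.
  by rewrite divr_gt0 ?mulr_gt0.
- by split=> //; rewrite (lt_le_trans yh)// ler_pM2r ?invr_gt0// ler_pM2l.
- rewrite -(ltr_pM2l lamgt0).
  have Sskew := skewadjoint_formally_adjoint skewS.
  apply: le_lt_trans (skew_lower_bound lamR Sskew (domB dh dg)) _.
  rewrite appB//.
  have -> : lam *: (h - g) + (S h - S g) =
      (y - (lam *: g + S g)) - (y - (lam *: h + S h)).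
    by rewrite opprB [RHS]addrC subrKA opprD addrACA scalerBr.
  by rewrite (le_lt_trans (ler_normB _ _))// [ltRHS]splitr ltrD.
have [dh Sh] : dom S h /\ S h = y - lam *: h; last first.
  by exists h => //=; rewrite Sh addrC subrK.
apply: skewadjoint_closed => // e e0.
pose f := e / (2 * `|lam| + 1).
have l1 : 0 < 2 * `|lam| + 1 by rewrite ltr_wpDl ?mulr_ge0.
have f0 : 0 < f by rewrite divr_gt0.
have lf0 : 0 <= `|lam| * f by rewrite mulr_ge0// ltW.
have fe : e = `|lam| * f / 2 + `|lam| * f + (`|lam| * f / 2 + f).
  have -> : e = f * (2 * `|lam| + 1) by rewrite divfK ?gt_eqF.
  by field.
have [g [dg yg] hg] := hA _ f0; exists g => //; split.
  by rewrite (lt_le_trans hg)// fe addrA lerDr !addr_ge0// divr_ge0.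
have -> : y - lam *: h - S g = (y - (lam *: g + S g)) - lam *: (h - g).
  rewrite scalerBr opprB opprD [- (lam *: g) - _]addrC [y + (_ - _)]addrA.
  by rewrite subrKA addrAC.
rewrite (le_lt_trans (ler_normB _ _))// normrZ.
apply: (@lt_le_trans _ _ (`|lam| * f / 2 + `|lam| * f)).
  by rewrite ltrD// ltr_pM2l.
by rewrite fe lerDl addr_ge0 ?(ltW f0)// divr_ge0.
Qed.

Lemma skewadjoint_ran_sub lam :
  skewadjoint ip S -> lam \is Num.real -> lam != 0 ->
  ran (scalar_sub lam S) = setT.
Proof.
move=> skewS lamR lam0; apply/seteqP; split=> // y _.
have : ran (scalar_add (- lam) S) (- y).
  by rewrite skewadjoint_ran_add ?realN ?oppr_eq0.
move=> [h dh /= hy]; exists h => //=.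
by apply: oppr_inj; rewrite -hy opprB scaleNr addrC.
Qed.

(** By [sub_add], what is known about pairings of dom S with lam g + S g
    becomes information about pairings of g with ran (lam - S), and density of
    this range then determines g. Surjectivity of lam + S lets any vector be
    written as lam g + S g. *)
Lemma skewadjoint_of_ran lam :
  lam \is Num.real -> formally_adjoint ip S (pmap_opp S) ->
  ran (scalar_add lam S) = setT -> closure (ran (scalar_sub lam S)) = setT ->
  skewadjoint ip S.
Proof.
move=> lamR Sskew ranT /closure_eqT ranD.
have surj y : exists2 g, dom S g & lam *: g + S g = y.
  by have : ran (scalar_add lam S) y by rewrite ranT.
have sub_add h g : dom S h -> dom S g ->
    ip (lam *: h - S h) g = ip h (lam *: g + S g).
  move=> dh dg; rewrite ipDl ipNl ipZl (Sskew h g dh dg) /= ipNr opprK ipDr.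
  by rewrite (ip_real_scaler _ theta_conj).
have dS : norm_dense (dom S).
  apply: (dense_of_orthogonal_eq0 theta_conj ip_norm Kinf dom0 domP) => y yorth.
  have [g dg gy] := surj y.
  suff g0 : g = 0.
    by rewrite -gy; have := appB dg dg; rewrite g0 !subrr scaler0 add0r => ->.
  apply: (dense_orthogonal_eq0 theta_conj ip_norm ranD) => _ [h dh <-] /=.
  by rewrite sub_add// gy yorth.
have adj_opp k k' : adjoint_rel ip S k k' -> dom S k /\ k' = - S k.
  move=> adj; have [g dg gk] := surj (lam *: k - k').
  suff kg : k = g.
    by move: gk; rewrite -kg => /addrI ->; rewrite opprK kg.
  apply/eqP; rewrite -subr_eq0; apply/eqP.
  apply: (dense_orthogonal_eq0 theta_conj ip_norm ranD) => _ [h dh <-] /=.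
  rewrite ipDr ipNr (sub_add h g)// gk ipDl ipNl ipZl (adj h dh) ipDr ipNr.
  by rewrite (ip_real_scaler _ theta_conj)// subrr.
split; first by rewrite /densely_defined; apply/denseP.
split=> [|k /(xgetPex 0)/adj_opp[]//].
apply/seteqP; split=> k /=; first by move=> [k' /adj_opp[]].
by exists (- S k) => h dh; exact: Sskew.
Qed.

End Skewadjoint.

Theorem corollary3p2 (R : realType) (k : scalar_kind)
    (H : completeNormedModType (scalar_field R k))
    (ip : {dot H for @scalar_conj R k}) (ip_norm : norm_of_dot ip)
    (S : partial_map H) (S_linear : linear_operator S) :
  (skewadjoint ip S <->
   exists lam : scalar_field R k,
     [/\ lam \is Num.real, lam != 0,
         formally_adjoint ip S (pmap_opp S),
         ran (scalar_add lam S) = setT &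
         closure (ran (scalar_sub lam S)) = setT])
  /\
  (skewadjoint ip S <->
   forall lam : scalar_field R k, lam \is Num.real -> lam != 0 ->
     [/\ formally_adjoint ip S (pmap_opp S),
         ran (scalar_add lam S) = setT &
         closure (ran (scalar_sub lam S)) = setT]).
Proof.
have conjP := @scalar_conj_conjugation R k.
have infP := @scalar_field_inf R k.
have skew_all lam : skewadjoint ip S -> lam \is Num.real -> lam != 0 ->
    [/\ formally_adjoint ip S (pmap_opp S), ran (scalar_add lam S) = setT &
        closure (ran (scalar_sub lam S)) = setT].
  move=> skewS lamR lam0; split; first exact: skewadjoint_formally_adjoint.
    exact: (skewadjoint_ran_add conjP ip_norm infP S_linear).
  by rewrite (skewadjoint_ran_sub conjP ip_norm infP S_linear)// closureT.
have some_skew := skewadjoint_of_ran conjP ip_norm infP S_linear.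
split; split.
- move=> skewS; exists 1.
  by have [] := skew_all 1 skewS (real1 _) (oner_neq0 _).
- by move=> [lam [lamR _]]; exact: some_skew.
- by move=> skewS lam; exact: skew_all.
- move=> all; have [] := all 1 (real1 _) (oner_neq0 _).
  exact: some_skew (real1 _).
Qed.
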